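(* Let $X$ be a closed connected manifold and let $f,g:X\to X$ be self maps whose induced homomorphisms $f_*,g_*$ on $\pi_1(X)$ commute. Let $n$ be a positive integer and let $P(n)=\{p(1),p(2),\dots,p(k)\}$ be the set of primes dividing $n$. Suppose that the pair $f,g$ is coincidence essentially reducible. Then $$N(f^n,g^n)\ \ge\ NP_n(f,g)\ \ge\ N(f^n,g^n)-\sum_{i=1}^k N(f^{n:i},g^{n:i}),$$ where $n:i=n\cdot(p(i))^{-1}$.
   Context: Maps are continuous and $f^n$ denotes the $n$-th iterate. $X$ is a closed connected manifold with base point $x_0$; the maps $f,g:X\to X$ are taken (without loss of generality, up to homotopy) to preserve $x_0$, with induced homomorphisms $f_*,g_*:\pi_1(X,x_0)\to\pi_1(X,x_0)$ satisfying $f_*g_*=g_*f_*$. Geometric classes: $\Phi(f^n,g^n)=\{x\in X: f^n(x)=g^n(x)\}$. Points $x,y\in\Phi(f^n,g^n)$ are Nielsen equivalent at level $n$ if there is a path $c$ from $x$ to $y$ with $f^n(c)\simeq g^n(c)$ relative to end points. Each Nielsen class $\mathbf A^n$ has an integer $\mathrm{ind}(\mathbf A^n)$, its coincidence index (the coincidence semi-index when $X$ is not orientable). Algebraic classes: $\mathcal R(f_*^n,g_*^n)$ is the set of Reidemeister classes $[\alpha]^n$, i.e. equivalence classes of $\pi_1(X,x_0)$ under $\alpha\sim\beta$ iff $\alpha=g_*^n(\gamma)\,\beta\,f_*^n(\gamma^{-1})$ for some $\gamma\in\pi_1(X,x_0)$. There is an injection $\rho_n$ from Nielsen classes to $\mathcal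 R(f_*^n,g_*^n)$ given by $\rho_n(\mathbf A^n)=[g^n(c)f^n(c^{-1})]^n$, where $c$ is any path from $x_0$ to any $x\in\mathbf A^n$. Put $\mathrm{Ind}([\alpha]^n)=\mathrm{ind}(\mathbf A^n)$ if $[\alpha]^n=\rho_n(\mathbf A^n)$ and $\mathrm{Ind}([\alpha]^n)=0$ otherwise. A class $[\alpha]^n$ is essential if $\mathrm{Ind}([\alpha]^n)\neq0$. $N(f^n,g^n)$ (the Nielsen number) is the number of essential classes at level $n$. Boosting: for $m\mid n$, $\iota_{m,n}:\mathcal R(f_*^m,g_*^m)\to\mathcal R(f_*^n,g_*^n)$ is induced by $$\iota_{m,n}(\alpha)=g_*^{n-m}(\alpha)\,g_*^{n-2m}f_*^{m}(\alpha)\cdots g_*^{m}f_*^{n-2m}(\alpha)\,f_*^{n-m}(\alpha).$$ $[\alpha]^n$ reduces to $[\beta]^m$ if $m\mid n$ and $\iota_{m,n}([\beta]^m)=[\alpha]^n$; $[\alpha]^n$ is irreducible if it does not reduce to any level $m<n$. $NP_n(f,g)$ is the number of irreducible essential Reidemeister classes in $\mathcal R(f_*^n,g_*^n)$. The pair $f,g$ is coincidence essentially reducible if, for every essential class $[\alpha]^n$ of $f^n$ and $g^n$ (any $n$), whenever $[\alpha]^n$ reduces to $[\beta]^m$, the class $[\beta]^m$ is also essential. *)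

(* Defs.v *)
From mathcomp Require Import all_boot all_order all_algebra finmap.
From mathcomp Require Import all_classical all_reals all_analysis.
From mathcomp Require Import freeg.

Set Implicit Arguments.
Unset Strict Implicit.
Unset Printing Implicit Defensive.
Import Order.TTheory GRing.Theory Num.Theory.
Import numFieldNormedType.Exports.

Local Open Scope classical_set_scope.
Local Open Scope ring_scope.

Section manifold.
Variables (R : realType) (d : nat) (X : topologicalType).

(* [V] is an open subset of [X] homeomorphic to the Euclidean space R^d; [h] is
   the inverse of a chart. *)
Definition euclidean_open (V : set X) : Prop :=
  exists h : 'rV[R]_d -> X,
    [/\ continuous h, injective h,
        forall O : set 'rV[R]_d, open O -> open (h @` O) & range h = V].

(* Second countability is automatic, by compactness. *)
Definition closed_manifold : Prop :=
  [/\ hausdorff_space X, compact [set: X] &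
      forall x : X, exists2 V, euclidean_open V & V x].

End manifold.

Section paths.
Variables (R : realType) (X : topologicalType).
Implicit Types (x y : X) (c : R -> X).

(* Only the values of a path on [0, 1] are relevant. *)
Definition is_path x y c : Prop :=
  [/\ {within `[0, 1], continuous c}, c 0 = x & c 1 = y].

Definition path_cat c1 c2 : R -> X :=
  fun t => if t <= 2^-1 then c1 (2 * t) else c2 (2 * t - 1).

Definition path_rev c : R -> X := fun t => c (1 - t).

(* [H (s, t)] is the point of parameter [t] on the path of stage [s]. *)
Definition path_homotopic x y c1 c2 : Prop :=
  exists H : R * R -> X,
    [/\ {within `[0, 1] `*` `[0, 1], continuous H},
        forall t, t \in `[0, 1] -> H (0, t) = c1 t /\ H (1, t) = c2 t &
        forall s, s \in `[0, 1] -> H (s, 0) = x /\ H (s, 1) = y].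

Variable x0 : X.

(* The homotopy class of a loop; elements of the fundamental group are such
   sets of loops, and the group operations act on these sets. *)
Definition loop_class c : set (R -> X) := [set c' | path_homotopic x0 x0 c c'].

Definition pi1 : set (set (R -> X)) :=
  [set a | exists2 c, is_path x0 x0 c & a = loop_class c].

Implicit Types a b : set (R -> X).

Definition pi1_one : set (R -> X) := loop_class (cst x0).

Definition pi1_mul a b : set (R -> X) :=
  [set c | exists c1 c2, [/\ a c1, b c2 & loop_class (path_cat c1 c2) c]].

Definition pi1_inv a : set (R -> X) :=
  [set c | exists2 c1, a c1 & loop_class (path_rev c1) c].

(* meaningful when [f x0 = x0] *)
Definition pi1_map (f : X -> X) a : set (R -> X) :=
  [set c | exists2 c1, a c1 & loop_class (f \o c1) c].

End paths.

Section simplex.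
Variable R : realType.

Definition stdsimplex (k : nat) : set 'rV[R]_k.+1 :=
  [set v | (forall i, 0 <= v 0 i) /\ \sum_i v 0 i = 1].
Arguments stdsimplex k : clear implicits.

Definition face_map k (i : 'I_k.+2) (v : 'rV[R]_k.+1) : 'rV[R]_k.+2 :=
  \row_j (if unlift i j is Some j' then v 0 j' else 0).

Lemma face_map_stdsimplex k (i : 'I_k.+2) (v : stdsimplex k) :
  face_map i (val v) \in stdsimplex k.+1.
Proof.
case: v => v /= /set_mem[v0 v1]; apply/mem_set; split=> [j|].
  by rewrite mxE; case: unlift.
rewrite (bigD1_ord i)//= mxE unlift_none add0r -v1.
by apply: eq_bigr => j _; rewrite mxE liftK.
Qed.

Definition face k (i : 'I_k.+2) (v : stdsimplex k) : stdsimplex k.+1 :=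
  exist _ (face_map i (val v)) (face_map_stdsimplex i v).

End simplex.

Arguments stdsimplex : clear implicits.

Section chains.
Variables (R : realType) (T : topologicalType).

(* Continuity of the simplices is imposed by [chain_in] below. *)
Definition chain (k : nat) := {freeg (stdsimplex R k -> T) / int}.

Definition boundary (k : nat) : chain k -> chain k.-1 :=
  match k with
  | 0 => fun=> 0
  | k'.+1 => fglift (fun s : stdsimplex R k'.+1 -> T =>
      \sum_(i < k'.+2) << ((-1) ^+ i : int) *g (s \o face i) >>)
  end.

(* [z] is a singular chain of the subspace [A] *)
Definition chain_in (k : nat) (A : set T) (z : chain k) : Prop :=
  forall s, s \in dom z -> continuous s /\ range s `<=` A.

(* relative cycles of the pair [(A, B)], for [B `<=` A], and the relation of
   being homologous in H_k(A, B) *)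
Definition relcycle (k : nat) (A B : set T) (z : chain k) : Prop :=
  chain_in A z /\ chain_in B (boundary z).

Definition homologous (k : nat) (A B : set T) (z z' : chain k) : Prop :=
  exists (w : chain k.+1) (b : chain k),
    [/\ chain_in A w, chain_in B b & z - z' = boundary w + b].

End chains.

Definition chain_map (R : realType) (T U : topologicalType) (k : nat)
    (phi : T -> U) : chain R T k -> chain R U k :=
  fglift (fun s : stdsimplex R k -> T => << phi \o s >>).

Section orientation.
Variables (R : realType) (d : nat) (X : topologicalType).

(* [o] represents a generator of the infinite cyclic group H_d(X, X - x) *)
Definition local_orientation (x : X) (o : chain R X d) : Prop :=
  relcycle setT (~` [set x]) o /\
  forall z : chain R X d, relcycle setT (~` [set x]) z ->
    exists k : int, homologous setT (~` [set x]) z (o *~ k).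

(* A continuous choice [o s] of a local orientation of [X] at [phi s], for [s]
   in [D].  For [phi] the identity this is an orientation of [X]; for [phi] a
   path, [o 1] is the transport of [o 0] along this path. *)
Definition oriented_along (S : topologicalType) (D : set S) (phi : S -> X)
    (o : S -> chain R X d) : Prop :=
  (forall s, D s -> local_orientation (phi s) (o s)) /\
  forall s, D s -> exists (U : set X) (z : chain R X d),
    [/\ open U, U (phi s), relcycle setT (~` U) z &
        \forall s' \near within D (nbhs s),
          homologous setT (~` [set phi s']) z (o s')].

Definition orientation (o : X -> chain R X d) : Prop :=
  oriented_along setT id o.

Definition orientable : Prop := exists o, orientation o.

End orientation.

Section coincidence.
Variables (R : realType) (d : nat) (X : topologicalType).
Implicit Types (F G : X -> X) (A V : set X).

Definition coin F G : set X := [set x | F x = G x].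

Definition nielsen_equiv F G (x y : X) : Prop :=
  exists2 c : R -> X, is_path x y c &
    path_homotopic (F x) (F y) (F \o c) (G \o c).

Definition nielsen_class F G A : Prop :=
  exists2 x, coin F G x &
    A = [set y | coin F G y /\ nielsen_equiv F G x y].

(* The index of an isolated compact set [A] of coincidences, for maps taking
   values in [V] near [A].  The chain [z] represents the fundamental class of
   [A], as prescribed by the local orientations [o x] of the source; [w]
   represents the local orientation [o'] of the target at [y].  The equation
   (F, G)_* [z] = k [{y} x w] holds in H_d(V x V, V x V - diagonal), which is
   infinite cyclic and generated by [{y} x w] if [V] is connected and oriented
   by [o'].  At an isolated coincidence in coordinates, [k] is the local degree
   of [x |-> G x - F x]. *)
Definition has_index F G A V (o : X -> chain R X d) (y : X)
    (o' : chain R X d) (k : int) : Prop :=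
  exists (U : set X) (z w : chain R X d),
  [/\ [/\ open U, U `&` coin F G = A, F @` U `<=` V & G @` U `<=` V],
      relcycle U (U `\` A) z /\
        (forall x, A x -> homologous setT (~` [set x]) z (o x)),
      [/\ V y, relcycle V (V `\ y) w & homologous setT (~` [set y]) w o'] &
      homologous (V `*` V) ((V `*` V) `\` [set p | p.1 = p.2])
        (chain_map (fun x => (F x, G x)) z) (chain_map (pair y) w *~ k)].

Definition coincidence_index F G A (k : int) : Prop :=
  exists (o : X -> chain R X d) (y : X),
    orientation o /\ has_index F G A setT o y (o y) k.

(* The index of an isolated coincidence [x], with respect to local orientations
   [o] of the source at [x] and [o'] of the target at [F x = G x]. *)
Definition local_index F G (x : X) (o o' : chain R X d) (k : int) : Prop :=
  exists2 V, euclidean_open R d V &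
    has_index F G [set x] V (fun=> o) (F x) o' k.

(* Topological form of transversality: finitely many coincidences, each of
   local index 1 or -1 (the sign depends on the local orientations). *)
Definition regular_pair F G : Prop :=
  finite_set (coin F G) /\
  forall x, coin F G x -> exists o o',
    [/\ local_orientation x o, local_orientation (F x) o' &
        local_index F G x o o' 1].

(* The coincidences [x] and [y] reduce each other: along a path [c] establishing
   their Nielsen equivalence, their local indices are opposite, the local
   orientations of the source being transported along [c] and those of the
   target along [F \o c].  It may be that [x = y]. *)
Definition reduce_each_other F G (x y : X) : Prop :=
  exists (c : R -> X) (o o' : R -> chain R X d) (k : int),
  [/\ is_path x y c, path_homotopic (F x) (F y) (F \o c) (G \o c),
      oriented_along (`[0, 1] : set R) c o, oriented_along (`[0, 1] : set R) (F \o c) o' &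
      local_index F G x (o 0) (o' 0) k /\
      local_index F G y (o 1) (o' 1) (- k)].

(* [s] is the number of free elements in a decomposition
   A = {a_1, b_1, ..., a_k, b_k; c_1, ..., c_s} where each pair a_i, b_i reduce
   each other and no distinct c_i, c_j do. *)
Definition free_number F G A (s : nat) : Prop :=
  exists (ab : seq (X * X)) (c : seq X),
  [/\ uniq (unzip1 ab ++ unzip2 ab ++ c),
      [set` unzip1 ab ++ unzip2 ab ++ c] = A,
      forall p, p \in ab -> reduce_each_other F G p.1 p.2,
      forall x y, x \in c -> y \in c -> x != y -> ~ reduce_each_other F G x y &
      s = size c].

(* The semi-index of Dobrenko and Jezierski: deform [(F, G)] into a regular pair
   and count the free elements of the set of coincidences corresponding to [A]
   under the deformation. *)
Definition semi_index F G A (s : nat) : Prop :=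
  exists HF HG : R * X -> X,
  let F1 := fun x => HF (1, x) in
  let G1 := fun x => HG (1, x) in
  [/\ {within `[0, 1] `*` setT, continuous HF} /\
        {within `[0, 1] `*` setT, continuous HG},
      forall x, HF (0, x) = F x /\ HG (0, x) = G x,
      regular_pair F1 G1 &
      free_number F1 G1
        [set y | coin F1 G1 y /\
          exists x (c : R -> X), [/\ A x, is_path x y c &
            path_homotopic (F x) (F1 y)
              (fun t => HF (t, c t)) (fun t => HG (t, c t))]] s].

Definition ind F G A : int :=
  xget 0 [set k | (orientable R d X -> coincidence_index F G A k) /\
    (~ orientable R d X -> exists2 s : nat, semi_index F G A s & k = s%:Z)].

End coincidence.

Section reidemeister.
Variables (R : realType) (d : nat) (X : topologicalType) (x0 : X).
Variables f g : X -> X.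
Implicit Types (m n : nat) (a b c : set (R -> X)) (A B : set (set (R -> X))).

Local Notation fs n := (iter n (pi1_map x0 f)).
Local Notation gs n := (iter n (pi1_map x0 g)).
Local Notation "a ** b" := (pi1_mul x0 a b) (at level 40, left associativity).

Definition reid_equiv n a b : Prop :=
  exists2 c, pi1 x0 c & a = gs n c ** b ** fs n (pi1_inv x0 c).

Definition reid_class n a : set (set (R -> X)) :=
  [set b | pi1 x0 b /\ reid_equiv n a b].

Definition reid_classes n : set (set (set (R -> X))) :=
  [set reid_class n a | a in pi1 x0].

(* The Reidemeister class of the loop (g^n c)(f^n c)^-1, which does not depend
   on the point of the Nielsen class [N] nor on the path [c] to this point. *)
Definition rho n (N : set X) : set (set (R -> X)) :=
  [set b | exists x (c : R -> X), [/\ N x, is_path x0 x c &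
    reid_class n (loop_class x0
      (path_cat (iter n g \o c) (path_rev (iter n f \o c)))) b]].

Definition Ind n A : int :=
  if pselect (exists N, nielsen_class R (iter n f) (iter n g) N /\ rho n N = A)
    is left h then ind R d (iter n f) (iter n g) (sval (cid h))
  else 0.

Definition essential n A : Prop := reid_classes n A /\ Ind n A != 0.

(* [fset_set] is meaningful on finite sets: on a closed manifold there are
   finitely many Nielsen classes, hence finitely many essential classes. *)
Definition nielsen_number n : nat := #|` fset_set [set A | essential n A]|.

Definition boost m n a : set (R -> X) :=
  \big[pi1_mul x0/pi1_one x0]_(0 <= i < n %/ m)
    gs (n - i.+1 * m)%N (fs (i * m)%N a).

(* the map induced by [boost] on Reidemeister classes *)
Definition iota_class m n B : set (set (R -> X)) :=
  \bigcup_(b in B) reid_class n (boost m n b).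

Definition reduces_to n A m B : Prop := (m %| n)%N /\ iota_class m n B = A.

Definition irreducible_class n A : Prop :=
  forall m B, (m < n)%N -> reid_classes m B -> ~ reduces_to n A m B.

Definition NP n : nat :=
  #|` fset_set [set A | essential n A /\ irreducible_class n A]|.

Definition coincidence_essentially_reducible : Prop :=
  forall n A, (0 < n)%N -> essential n A ->
  forall m B, reid_classes m B -> reduces_to n A m B -> essential m B.

End reidemeister.

(* Main.v *)
Require Import Defs.
From HB Require Import structures.
From mathcomp Require Import all_boot all_order all_algebra finmap.
From mathcomp Require Import all_classical all_reals all_analysis.
From mathcomp Require Import ring lra zify.

Set Implicit Arguments.
Unset Strict Implicit.
Unset Printing Implicit Defensive.
Import Order.TTheory GRing.Theory Num.Theory.
Import numFieldNormedType.Exports.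
Local Open Scope classical_set_scope.
Local Open Scope ring_scope.

(** The first inequality holds because the irreducible essential classes are
    among the essential ones.  For the second, every essential class at level
    [n] that is reducible is the image under some [iota_class (n %/ p) n], with
    [p] a prime divisor of [n], of an essential class at level [n %/ p]; so the
    number of reducible essential classes is at most the sum of the Nielsen
    numbers at the levels [n %/ p].  Two ingredients make this work.

    Algebra.  If a class [A] reduces to [B] at level [m < n], choose a prime [p]
    dividing [n %/ m]; then [m] divides [n %/ p], and the boost of [B] to level
    [n %/ p] is an intermediate class to which [A] reduces, because boosting
    from [m] to [n] factors through every intermediate level.  This class is
    essential by essential reducibility.  The factorization
    ([twisted_boost_boost]) and the fact that boosting is well defined on
    Reidemeister classes ([twisted_boost_conj]) are computations in a group
    with two commuting endomorphisms, once the homotopy classes of loops are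
    known to form a group on which [f] and [g] induce endomorphisms.

    Topology.  Cardinals are those of [fset_set], which is empty on an infinite
    set, so that both inequalities need the essential classes to be finite in
    number.  An essential class is the image under [rho] of a Nielsen class, so
    it is enough that the Nielsen classes are finite in number
    ([finite_nielsen_classes]): two coincidences that are close to each other
    are joined by a short path, whose images under the two maps lie in a common
    chart and are homotopic there by straight lines; compactness concludes. *)

(** * Continuity on subsets *)

Lemma within_continuous_comp_sub (S T U : topologicalType) (A : set S)
    (B : set T) (u : S -> T) (c : T -> U) :
  {within B, continuous c} -> {within A, continuous u} ->
  (forall s, A s -> B (u s)) -> {within A, continuous (c \o u)}.
Proof.
move=> /subspace_continuousP cc /subspace_continuousP cu AB.
apply/subspace_continuousP => s As.
apply: cvg_comp (cc _ (AB _ As)).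
move=> W /= BW; rewrite /nbhs/=.
have := cu _ As _ BW; rewrite /= !nbhs_simpl/= /within/=.
by apply: filterS => y + Ay; apply => //; exact: AB.
Qed.

(** For the concatenations of paths and of homotopies, which are defined by cases
    on the position of one real coordinate [u] with respect to 1/2. *)
Lemma within_continuous_paste (R : realType) (S T : topologicalType)
    (A : set S) (u : S -> R) (r : R) (f g : S -> T) :
  closed A -> continuous u ->
  {within A `&` [set s | u s <= r], continuous f} ->
  {within A `&` [set s | r <= u s], continuous g} ->
  (forall s, A s -> u s = r -> f s = g s) ->
  {within A, continuous (fun s => if u s <= r then f s else g s)}.
Proof.
move=> clA cu cf cg fg.
have clB : closed (A `&` [set s | u s <= r]).
  apply: closedI => //.
  by apply: (@preimage_closed _ _ u [set x | x <= r]) => [x _|]; [exact: cu|exact: closed_le].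
have clC : closed (A `&` [set s | r <= u s]).
  apply: closedI => //.
  by apply: (@preimage_closed _ _ u [set x | r <= x]) => [x _|]; [exact: cu|exact: closed_ge].
have -> : A = (A `&` [set s | u s <= r]) `|` (A `&` [set s | r <= u s]).
  rewrite -setIUr; apply/esym/setIidPl => s _ /=.
  by have [|/ltW] := leP (u s) r; [left|right].
apply: withinU_continuous => //.
- apply: subspace_eq_continuous cf => s /set_mem[_ /= sr].
  by rewrite /from_subspace sr.
- apply: subspace_eq_continuous cg => s /set_mem[As /= rs]; rewrite /from_subspace.
  by case: ifPn => // sr; apply/esym/fg => //; apply/le_anti/andP.
Qed.

Lemma continuous_pair (S T U : topologicalType) (f : S -> T) (g : S -> U) :
  continuous f -> continuous g -> continuous (fun s => (f s, g s)).
Proof. by move=> cf cg s; apply: cvg_pair; [exact: cf|exact: cg]. Qed.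

Lemma continuous_maxr (R : realType) (f g : R -> R) : continuous f -> continuous g ->
  continuous (fun t => Num.max (f t) (g t)).
Proof. by move=> cf cg t; exact: (@continuous_max R _ f g t (cf t) (cg t)). Qed.

Lemma continuous_minr (R : realType) (f g : R -> R) : continuous f -> continuous g ->
  continuous (fun t => Num.min (f t) (g t)).
Proof. move=> cf cg t; exact: (@continuous_min R _ f g t (cf t) (cg t)). Qed.

(** * Homotopy of paths *)

Section path_homotopy.
Variables (R : realType) (X : topologicalType).
Implicit Types (x y z : X) (c : R -> X) (u v : R -> R).

Local Notation I01 := `[(0 : R), (1 : R)]%classic.

Lemma closed_unit_square : closed (I01 `*` I01).
Proof.
have cl : closed I01 by exact: itv_closed.
have -> : I01 `*` I01 = (fst @^-1` I01) `&` (snd @^-1` I01) by [].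
by apply: closedI; apply: preimage_closed => // p _; [exact: cvg_fst|exact: cvg_snd].
Qed.

Let twoB1 : 2 - 1 = 1 :> R.
Proof. by lra. Qed.

Lemma path_homotopicI x y c1 c2 (H : R * R -> X) :
  {within I01 `*` I01, continuous H} ->
  (forall t, 0 <= t <= 1 -> H (0, t) = c1 t) ->
  (forall t, 0 <= t <= 1 -> H (1, t) = c2 t) ->
  (forall s, 0 <= s <= 1 -> H (s, 0) = x) ->
  (forall s, 0 <= s <= 1 -> H (s, 1) = y) ->
  path_homotopic x y c1 c2.
Proof.
by move=> cH H0 H1 Hx Hy; exists H; split=> // t; rewrite in_itv/=; auto.
Qed.

Lemma path_homotopicE x y c1 c2 : path_homotopic x y c1 c2 ->
  exists H : R * R -> X,
  [/\ {within I01 `*` I01, continuous H},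
   forall t, 0 <= t <= 1 -> H (0, t) = c1 t,
  forall t, 0 <= t <= 1 -> H (1, t) = c2 t,
  forall s, 0 <= s <= 1 -> H (s, 0) = x &
  forall s, 0 <= s <= 1 -> H (s, 1) = y].
Proof.
move=> [H [cH Ht Hs]]; exists H; split=> // t t01.
- by have [] := Ht t; rewrite ?in_itv.
- by have [] := Ht t; rewrite ?in_itv.
- by have [] := Hs t; rewrite ?in_itv.
- by have [] := Hs t; rewrite ?in_itv.
Qed.

Lemma path_homotopic_eq x y c1 c2 c1' c2' :
  (forall t, 0 <= t <= 1 -> c1 t = c1' t) ->
  (forall t, 0 <= t <= 1 -> c2 t = c2' t) ->
  path_homotopic x y c1 c2 -> path_homotopic x y c1' c2'.
Proof.
move=> e1 e2 /path_homotopicE[H [cH H0 H1 Hx Hy]].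
by apply: (path_homotopicI cH) => // t t01; rewrite (H0, H1)// (e1, e2).
Qed.

Lemma path_homotopic_sym x y c1 c2 :
  path_homotopic x y c1 c2 -> path_homotopic x y c2 c1.
Proof.
move=> /path_homotopicE[H [cH H0 H1 Hx Hy]].
apply: (@path_homotopicI _ _ _ _ (H \o (fun p => (1 - p.1, p.2)))) => /=.
- apply: within_continuous_comp_sub cH _ _.
    apply: continuous_subspaceT; apply: continuous_pair => p; last exact: cvg_snd.
    by apply: cvgB; [exact: cvg_cst|exact: cvg_fst].
  by move=> p /=; rewrite !in_itv/= => -[? ?]; split; lra.
- by move=> t t01; rewrite subr0 H1.
- by move=> t t01; rewrite subrr H0.
- by move=> s s01; rewrite Hx//; lra.
- by move=> s s01; rewrite Hy//; lra.
Qed.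

Lemma path_homotopic_trans x y c1 c2 c3 :
  path_homotopic x y c1 c2 -> path_homotopic x y c2 c3 ->
  path_homotopic x y c1 c3.
Proof.
move=> /path_homotopicE[H [cH H0 H1 Hx Hy]] /path_homotopicE[K [cK K0 K1 Kx Ky]].
apply: (@path_homotopicI _ _ _ _ (fun p => if p.1 <= 2^-1
   then (H \o (fun p => (2 * p.1, p.2))) p
   else (K \o (fun p => (2 * p.1 - 1, p.2))) p)) => /=.
- apply: within_continuous_paste.
  + exact: closed_unit_square.
  + by move=> p; exact: cvg_fst.
  + apply: within_continuous_comp_sub cH _ _.
      apply: continuous_subspaceT; apply: continuous_pair => p; last exact: cvg_snd.
      by apply: cvgM; [exact: cvg_cst|exact: cvg_fst].
    by move=> p [] /=; rewrite !in_itv/= => -[? ?] ?; split; lra.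
  + apply: within_continuous_comp_sub cK _ _.
      apply: continuous_subspaceT; apply: continuous_pair => p; last exact: cvg_snd.
      by apply: cvgB; [apply: cvgM; [exact: cvg_cst|exact: cvg_fst]|exact: cvg_cst].
    by move=> p [] /=; rewrite !in_itv/= => -[? ?] ?; split; lra.
  + move=> [s t] /=; rewrite !in_itv/= => -[? ?] ->.
    by rewrite mulfV// subrr H1// K0.
- by move=> t t01; rewrite ifT ?mulr0 ?H0//; lra.
- by move=> t t01; rewrite ifN -?ltNge ?mulr1 ?twoB1 ?K1//; lra.
- by move=> s s01; case: ifPn => ?; rewrite ?Hx ?Kx//; lra.
- by move=> s s01; case: ifPn => ?; rewrite ?Hy ?Ky//; lra.
Qed.

Lemma path_homotopic_cat x y z c1 c2 c1' c2' :
  path_homotopic x y c1 c1' -> path_homotopic y z c2 c2' ->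
  path_homotopic x z (path_cat c1 c2) (path_cat c1' c2').
Proof.
move=> /path_homotopicE[H [cH H0 H1 Hx Hy]] /path_homotopicE[K [cK K0 K1 Kx Ky]].
apply: (@path_homotopicI _ _ _ _ (fun p => if p.2 <= 2^-1
   then (H \o (fun p => (p.1, 2 * p.2))) p
   else (K \o (fun p => (p.1, 2 * p.2 - 1))) p)) => /=.
- apply: within_continuous_paste.
  + exact: closed_unit_square.
  + by move=> p; exact: cvg_snd.
  + apply: within_continuous_comp_sub cH _ _.
      apply: continuous_subspaceT; apply: continuous_pair => p; first exact: cvg_fst.
      by apply: cvgM; [exact: cvg_cst|exact: cvg_snd].
    by move=> p [] /=; rewrite !in_itv/= => -[? ?] ?; split; lra.
  + apply: within_continuous_comp_sub cK _ _.
      apply: continuous_subspaceT; apply: continuous_pair => p; first exact: cvg_fst.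
      by apply: cvgB; [apply: cvgM; [exact: cvg_cst|exact: cvg_snd]|exact: cvg_cst].
    by move=> p [] /=; rewrite !in_itv/= => -[? ?] ?; split; lra.
  + move=> [s t] /=; rewrite !in_itv/= => -[? ?] ->.
    by rewrite mulfV// subrr Hy// Kx.
- by move=> t t01; rewrite /path_cat; case: ifPn => ?; rewrite ?H0 ?K0//; lra.
- by move=> t t01; rewrite /path_cat; case: ifPn => ?; rewrite ?H1 ?K1//; lra.
- by move=> t t01; rewrite ifT ?mulr0 ?Hx//; lra.
- by move=> t t01; rewrite ifN -?ltNge ?mulr1 ?twoB1 ?Ky//; lra.
Qed.

Lemma path_homotopic_rev x y c1 c2 : path_homotopic x y c1 c2 ->
  path_homotopic y x (path_rev c1) (path_rev c2).
Proof.
move=> /path_homotopicE[H [cH H0 H1 Hx Hy]].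
apply: (@path_homotopicI _ _ _ _ (H \o (fun p => (p.1, 1 - p.2)))) => /=.
- apply: within_continuous_comp_sub cH _ _.
    apply: continuous_subspaceT; apply: continuous_pair => p; first exact: cvg_fst.
    by apply: cvgB; [exact: cvg_cst|exact: cvg_snd].
  by move=> p /=; rewrite !in_itv/= => -[? ?]; split; lra.
- by move=> t t01; rewrite H0//; lra.
- by move=> t t01; rewrite H1//; lra.
- by move=> s s01; rewrite subr0 Hy.
- by move=> s s01; rewrite subrr Hx.
Qed.

Lemma path_homotopic_map (Y : topologicalType) (f : X -> Y) x y c1 c2 :
  continuous f -> path_homotopic x y c1 c2 ->
  path_homotopic (f x) (f y) (f \o c1) (f \o c2).
Proof.
move=> cf /path_homotopicE[H [cH H0 H1 Hx Hy]].
exists (f \o H); split.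
- by apply: within_continuous_comp cH => p _; exact: cf.
- by move=> t; rewrite in_itv/= => t01; rewrite H0 ?H1.
- by move=> t; rewrite in_itv/= => t01; rewrite Hx ?Hy.
Qed.

(** The convexity of [0, 1] gives a homotopy between any two ways of running
    through the same path [c]; [u] and [v] may go back and forth.  The group
    laws up to homotopy are all instances of this lemma. *)
Lemma path_homotopic_reparam x y c u v :
  {within I01, continuous c} -> continuous u -> continuous v ->
  (forall t, 0 <= t <= 1 -> 0 <= u t <= 1) ->
  (forall t, 0 <= t <= 1 -> 0 <= v t <= 1) ->
  u 0 = v 0 -> u 1 = v 1 -> c (u 0) = x -> c (u 1) = y ->
  path_homotopic x y (c \o u) (c \o v).
Proof.
move=> cc cu cv u01 v01 uv0 uv1 ux uy.
apply: (@path_homotopicI _ _ _ _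
  (c \o (fun p => (1 - p.1) * u p.2 + p.1 * v p.2))) => /=.
- apply: within_continuous_comp_sub cc _ _.
    apply: continuous_subspaceT => p.
    apply: cvgD; apply: cvgM.
    + by apply: cvgB; [exact: cvg_cst|exact: cvg_fst].
    + by apply: (@continuous_comp _ _ _ snd u); [exact: cvg_snd|exact: cu].
    + exact: cvg_fst.
    + by apply: (@continuous_comp _ _ _ snd v); [exact: cvg_snd|exact: cv].
  move=> [s t] /=; rewrite !in_itv/= => -[s01 t01].
  have := u01 _ t01; have := v01 _ t01; nra.
- by move=> t t01; rewrite subr0 mul1r mul0r addr0.
- by move=> t t01; rewrite subrr mul1r mul0r add0r.
- by move=> s s01; rewrite -ux; congr c; rewrite -uv0; ring.
- by move=> s s01; rewrite -uy; congr c; rewrite -uv1; ring.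
Qed.

Lemma path_homotopic_refl x y c : is_path x y c -> path_homotopic x y c c.
Proof.
move=> [cc c0 c1]; apply: (@path_homotopic_reparam _ _ c id id) => //.
- by move=> p; exact: cvg_id.
- by move=> p; exact: cvg_id.
Qed.

Lemma is_path_cst x : is_path x x (cst x : R -> X).
Proof. by split=> //; apply: continuous_subspaceT => t; exact: cvg_cst. Qed.

Lemma is_path_rev x y c : is_path x y c -> is_path y x (path_rev c).
Proof.
move=> [cc c0 c1]; split; rewrite /path_rev ?subr0 ?subrr//.
apply: within_continuous_comp_sub cc _ _.
  by apply: continuous_subspaceT => t; apply: cvgB; [exact: cvg_cst|exact: cvg_id].
by move=> t /=; rewrite !in_itv/= => ?; lra.
Qed.

Lemma is_path_cat x y z c1 c2 : is_path x y c1 -> is_path y z c2 ->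
  is_path x z (path_cat c1 c2).
Proof.
move=> [cc1 c10 c11] [cc2 c20 c21]; split; rewrite /path_cat.
- apply: within_continuous_paste => /=.
  + exact: itv_closed.
  + by move=> t; exact: cvg_id.
  + apply: within_continuous_comp_sub cc1 _ _.
      by apply: continuous_subspaceT => t; apply: cvgM; [exact: cvg_cst|exact: cvg_id].
    by move=> t [] /=; rewrite !in_itv/= => ? ?; lra.
  + apply: within_continuous_comp_sub cc2 _ _.
      apply: continuous_subspaceT => t; apply: cvgB; last exact: cvg_cst.
      by apply: cvgM; [exact: cvg_cst|exact: cvg_id].
    by move=> t [] /=; rewrite !in_itv/= => ? ?; lra.
  + by move=> t _ ->; rewrite mulfV// subrr c11.
- by rewrite ifT ?mulr0//; lra.
- by rewrite ifN -?ltNge ?mulr1 ?twoB1//; lra.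
Qed.

Lemma is_path_map (Y : topologicalType) (f : X -> Y) x y c :
  continuous f -> is_path x y c -> is_path (f x) (f y) (f \o c).
Proof.
move=> cf [cc c0 c1]; split; rewrite /= ?c0 ?c1//.
by apply: within_continuous_comp cc => t _; exact: cf.
Qed.

Lemma path_revK c : path_rev (path_rev c) = c.
Proof. by apply/funext => t; rewrite /path_rev subKr. Qed.

Lemma path_cat_cstl x y c : is_path x y c ->
  path_homotopic x y (path_cat (cst x) c) c.
Proof.
move=> [cc c0 c1].
apply: (@path_homotopic_eq _ _ (c \o (fun t => Num.max 0 (2 * t - 1))) (c \o id)) => //.
  move=> t t01; rewrite /path_cat/=; case: ifPn => ht.
    by rewrite max_l ?c0//; lra.
  by rewrite max_r//; lra.
apply: path_homotopic_reparam => //.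
- apply: continuous_maxr => t; first exact: cvg_cst.
  apply: cvgB; last exact: cvg_cst.
  by apply: cvgM; [exact: cvg_cst|exact: cvg_id].
- by move=> t; exact: cvg_id.
- by move=> t t01; rewrite le_max ge_max; lra.
- by rewrite mulr0 add0r max_l//; lra.
- by rewrite mulr1 max_r//; lra.
- by rewrite mulr0 add0r max_l//; lra.
- by rewrite mulr1 twoB1 max_r.
Qed.

Lemma path_cat_cstr x y c : is_path x y c ->
  path_homotopic x y (path_cat c (cst y)) c.
Proof.
move=> [cc c0 c1].
apply: (@path_homotopic_eq _ _ (c \o (fun t => Num.min (2 * t) 1)) (c \o id)) => //.
  move=> t t01; rewrite /path_cat/=; case: ifPn => ht.
    by rewrite min_l//; lra.
  by rewrite min_r ?c1//; lra.
apply: path_homotopic_reparam => //.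
- apply: continuous_minr => t; last exact: cvg_cst.
  by apply: cvgM; [exact: cvg_cst|exact: cvg_id].
- by move=> t; exact: cvg_id.
- by move=> t t01; rewrite le_min ge_min; lra.
- by rewrite mulr0 min_l.
- by rewrite mulr1 min_r//; lra.
- by rewrite mulr0 min_l.
- by rewrite mulr1 min_r//; lra.
Qed.

(** Both sides run through [c]: the left one along the function
    [t |-> |2 t - 1|], the right one along the constant 1. *)
Lemma path_cat_revl x y c : is_path x y c ->
  path_homotopic y y (path_cat (path_rev c) c) (cst y).
Proof.
move=> [cc c0 c1].
apply: (@path_homotopic_eq _ _ (c \o (fun t => `|2 * t - 1|)) (c \o cst 1)) => //.
  move=> t t01; rewrite /path_cat/path_rev/=; case: ifPn => ht.
    by rewrite ler0_norm; [congr c|]; lra.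
  by rewrite ger0_norm//; lra.
apply: path_homotopic_reparam => //.
- move=> t; apply: cvg_norm; apply: cvgB; last exact: cvg_cst.
  by apply: cvgM; [exact: cvg_cst|exact: cvg_id].
- by move=> t; exact: cvg_cst.
- by move=> t t01; rewrite normr_ge0 ler_norml/=; lra.
- by move=> t t01 /=; lra.
- by rewrite mulr0 add0r normrN normr1.
- by rewrite mulr1 [2 - 1](_ : _ = 1) ?normr1//; lra.
- by rewrite mulr0 add0r normrN normr1.
- by rewrite mulr1 [2 - 1](_ : _ = 1) ?normr1//; lra.
Qed.

Lemma path_cat_revr x y c : is_path x y c ->
  path_homotopic x x (path_cat c (path_rev c)) (cst x).
Proof. by move=> /is_path_rev/path_cat_revl; rewrite path_revK. Qed.

(** The right-hand side is the left-hand side run through along a concave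
    function [v] with slopes 2, 1 and 1/2, written as a minimum of its three
    affine pieces. *)
Lemma path_catA x y z w c1 c2 c3 :
  is_path x y c1 -> is_path y z c2 -> is_path z w c3 ->
  path_homotopic x w (path_cat c1 (path_cat c2 c3)) (path_cat (path_cat c1 c2) c3).
Proof.
move=> p1 p2 p3.
have p123 := is_path_cat p1 (is_path_cat p2 p3).
have [cc c0 c1w] := p123; set c := path_cat c1 _ in cc c0 c1w *.
pose v (t : R) := Num.min (2 * t) (Num.min (t + 4^-1) ((t + 1) / 2)).
apply: (@path_homotopic_eq _ _ (c \o id) (c \o v)) => //.
  move=> t t01; rewrite /c /= /v.
  have [t1|t1] := leP t 4^-1.
    rewrite min_l; last by rewrite le_min; lra.
    by rewrite /path_cat !ifT//; lra.
  have [t2|t2] := leP t 2^-1.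
    rewrite min_r; last by rewrite ge_min; lra.
    rewrite min_l; last by lra.
    rewrite /path_cat ifN -?ltNge; last by lra.
    rewrite ifT; last by lra.
    rewrite ifT; last by lra.
    rewrite ifN -?ltNge; last by lra.
    by congr c2; lra.
  rewrite min_r; last by rewrite ge_min; lra.
  rewrite min_r; last by lra.
  rewrite /path_cat ifN -?ltNge; last by lra.
  rewrite ifN -?ltNge; last by lra.
  rewrite ifN -?ltNge; last by lra.
  by congr c3; lra.
apply: path_homotopic_reparam => //.
- by move=> t; exact: cvg_id.
- apply: continuous_minr; [|apply: continuous_minr] => t.
  + by apply: cvgM; [exact: cvg_cst|exact: cvg_id].
  + by apply: cvgD; [exact: cvg_id|exact: cvg_cst].
  + apply: cvgM; last exact: cvg_cst.
    by apply: cvgD; [exact: cvg_id|exact: cvg_cst].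
- by move=> t t01; rewrite /v !le_min !ge_min; lra.
- by rewrite /v mulr0 min_l// le_min; lra.
- rewrite /v min_r; last by rewrite ge_min; lra.
  by rewrite min_r; lra.
Qed.

End path_homotopy.

(** * The fundamental group *)

Section fundamental_group.
Variables (R : realType) (X : topologicalType) (x0 : X).
Implicit Types (c : R -> X) (a b : set (R -> X)).

Lemma loop_class_eq c1 c2 : path_homotopic x0 x0 c1 c2 ->
  loop_class x0 c1 = loop_class x0 c2.
Proof.
move=> c12; apply/seteqP; split=> c /=; apply: path_homotopic_trans => //.
exact: path_homotopic_sym.
Qed.

Lemma pi1_mulE c1 c2 : is_path x0 x0 c1 -> is_path x0 x0 c2 ->
  pi1_mul x0 (loop_class x0 c1) (loop_class x0 c2) =
  loop_class x0 (path_cat c1 c2).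
Proof.
move=> p1 p2; apply/seteqP; split=> [c [c1' [c2' [h1 h2]]]|c h] /=.
  by apply: path_homotopic_trans; exact: path_homotopic_cat h1 h2.
by exists c1, c2; split=> //; exact: path_homotopic_refl.
Qed.

Lemma pi1_invE c : is_path x0 x0 c ->
  pi1_inv x0 (loop_class x0 c) = loop_class x0 (path_rev c).
Proof.
move=> p; apply/seteqP; split=> [c' [c1 h]|c' h] /=.
  by apply: path_homotopic_trans; exact: path_homotopic_rev h.
by exists c => //; exact: path_homotopic_refl.
Qed.

Lemma pi1_mapE (f : X -> X) c : continuous f -> f x0 = x0 ->
  is_path x0 x0 c ->
  pi1_map x0 f (loop_class x0 c) = loop_class x0 (f \o c).
Proof.
move=> cf fx0 p; apply/seteqP; split=> [c' [c1 h]|c' h] /=.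
  apply: path_homotopic_trans.
  by have := path_homotopic_map cf h; rewrite fx0.
by exists c => //; exact: path_homotopic_refl.
Qed.

Lemma pi1_mulP a b : pi1 x0 a -> pi1 x0 b -> pi1 x0 (pi1_mul x0 a b).
Proof.
move=> [c1 p1 ->] [c2 p2 ->]; rewrite pi1_mulE//.
by exists (path_cat c1 c2) => //; exact: is_path_cat p1 p2.
Qed.

Lemma pi1_invP a : pi1 x0 a -> pi1 x0 (pi1_inv x0 a).
Proof.
move=> [c p ->]; rewrite pi1_invE//.
by exists (path_rev c) => //; exact: is_path_rev.
Qed.

Lemma pi1_oneP : pi1 x0 (@pi1_one R X x0).
Proof. by exists (cst x0) => //; exact: is_path_cst. Qed.

Lemma pi1_mapP (f : X -> X) a : continuous f -> f x0 = x0 ->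
  pi1 x0 a -> pi1 x0 (pi1_map x0 f a).
Proof.
move=> cf fx0 [c p ->]; rewrite pi1_mapE//; exists (f \o c) => //.
by have := is_path_map cf p; rewrite fx0.
Qed.

(** The operations of [pi1] are defined on all sets of loops; restricting them
    to homotopy classes is what makes the group laws hold. *)
Definition fundamental_group := set_type (@pi1 R X x0).
HB.instance Definition _ := Choice.on fundamental_group.
Implicit Types u v : fundamental_group.

Lemma pi1_val u : pi1 x0 (\val u).
Proof. exact: set_valP. Qed.

Definition fg_mul u v : fundamental_group :=
  exist (fun a => a \in pi1 x0) _ (mem_set (pi1_mulP (pi1_val u) (pi1_val v))).
Definition fg_inv u : fundamental_group :=
  exist (fun a => a \in pi1 x0) _ (mem_set (pi1_invP (pi1_val u))).
Definition fg_one : fundamental_group := exist (fun a => a \in pi1 x0) _ (mem_set pi1_oneP).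

Lemma fg_mulA : associative fg_mul.
Proof.
move=> u v w; apply/val_inj => /=.
have [c1 p1 ->] := pi1_val u; have [c2 p2 ->] := pi1_val v.
have [c3 p3 ->] := pi1_val w.
have p12 := is_path_cat p1 p2; have p23 := is_path_cat p2 p3.
by rewrite !pi1_mulE//; apply: loop_class_eq; exact: path_catA p1 p2 p3.
Qed.

Lemma fg_mul1 : left_id fg_one fg_mul.
Proof.
move=> u; apply/val_inj => /=; have [c p ->] := pi1_val u.
rewrite pi1_mulE//; last exact: is_path_cst.
by apply: loop_class_eq; exact: path_cat_cstl.
Qed.

Lemma fg_mulr1 : right_id fg_one fg_mul.
Proof.
move=> u; apply/val_inj => /=; have [c p ->] := pi1_val u.
rewrite pi1_mulE//; last exact: is_path_cst.
by apply: loop_class_eq; exact: path_cat_cstr.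
Qed.

Lemma fg_mulV : left_inverse fg_one fg_inv fg_mul.
Proof.
move=> u; apply/val_inj => /=; have [c p ->] := pi1_val u.
have p' := is_path_rev p; rewrite pi1_invE// pi1_mulE//.
by apply: loop_class_eq; exact: path_cat_revl p.
Qed.

Lemma fg_mulrV : right_inverse fg_one fg_inv fg_mul.
Proof.
move=> u; apply/val_inj => /=; have [c p ->] := pi1_val u.
have p' := is_path_rev p; rewrite pi1_invE// pi1_mulE//.
by apply: loop_class_eq; exact: path_cat_revr p.
Qed.

HB.instance Definition _ := isGroup.Build fundamental_group
  fg_mulA fg_mul1 fg_mulr1 fg_mulV fg_mulrV.

Definition fg_map (f : X -> X) (cf : continuous f) (fx0 : f x0 = x0) u :
    fundamental_group :=
  exist (fun a => a \in pi1 x0) _ (mem_set (pi1_mapP cf fx0 (pi1_val u))).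

Lemma fg_mapM (f : X -> X) (cf : continuous f) (fx0 : f x0 = x0) :
  {morph fg_map cf fx0 : u v / (u * v)%g}.
Proof.
move=> u v; apply/val_inj => /=.
have [c1 p1 ->] := pi1_val u; have [c2 p2 ->] := pi1_val v.
have p12 := is_path_cat p1 p2.
have q1 := is_path_map cf p1; have q2 := is_path_map cf p2.
rewrite fx0 in q1 q2.
rewrite pi1_mulE// !pi1_mapE// pi1_mulE//; congr loop_class.
by apply/funext => t; rewrite /path_cat/=; case: ifP.
Qed.

End fundamental_group.

Lemma prod_nat_mul (T : Type) (idx : T) (op : Monoid.law idx) (p q : nat)
    (F : nat -> T) :
  \big[op/idx]_(0 <= k < p * q) F k =
  \big[op/idx]_(0 <= i < p) \big[op/idx]_(0 <= j < q) F (i * q + j)%N.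
Proof.
elim: p => [|p IHp]; first by rewrite mul0n !big_geq.
rewrite mulSnr big_nat_recr//= -IHp (@big_cat_nat _ _ op (p * q))//=; last first.
  exact: leq_addr.
congr (op _ _); rewrite -{1}[(p * q)%N]add0n big_addn addKn.
by apply: eq_bigr => j _; rewrite addnC.
Qed.

(** * Boosting in a group with two commuting endomorphisms *)

Section twisted_conjugacy.
Variables (G : groupType) (phi psi : G -> G).
Hypotheses (phiM : {morph phi : x y / (x * y)%g})
  (psiM : {morph psi : x y / (x * y)%g})
  (phi_psi : forall x, phi (psi x) = psi (phi x)).
Implicit Types (a b c : G) (m n k : nat).

Definition twisted_conj n a b : Prop :=
  exists c, a = (iter n psi c * b * iter n phi c^-1)%g.

Definition twisted_boost m n a : G :=
  (\big[*%g/1]_(0 <= i < n %/ m) iter (n - i.+1 * m) psi (iter (i * m) phi a))%g.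

Lemma iter_morphM (h : G -> G) : {morph h : x y / (x * y)%g} ->
  forall n, {morph iter n h : x y / (x * y)%g}.
Proof. by move=> hM; elim=> [//|n IHn] x y; rewrite !iterS IHn hM. Qed.

Lemma morph1g (h : G -> G) : {morph h : x y / (x * y)%g} -> h 1%g = 1%g.
Proof. by move=> hM; apply: (@mulgI _ (h 1%g)); rewrite -hM !mulg1. Qed.

Lemma morphVg (h : G -> G) : {morph h : x y / (x * y)%g} ->
  {morph h : x / x^-1%g}.
Proof.
by move=> hM x; apply: (@mulgI _ (h x)); rewrite -hM !mulgV; exact: morph1g.
Qed.

Let phinM n := iter_morphM phiM n.
Let psinM n := iter_morphM psiM n.

Lemma iter_comm m n a :
  iter m phi (iter n psi a) = iter n psi (iter m phi a).
Proof.
have phi1 k x : phi (iter k psi x) = iter k psi (phi x).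
  by elim: k => [//|k IHk]; rewrite !iterS phi_psi IHk.
by elim: m a => [//|m IHm] a; rewrite !iterS IHm phi1.
Qed.

Lemma twisted_conj_refl n a : twisted_conj n a a.
Proof.
by exists 1%g; rewrite invg1 !(morph1g (phinM _), morph1g (psinM _)) mulg1 mul1g.
Qed.

Lemma twisted_conj_sym n a b : twisted_conj n a b -> twisted_conj n b a.
Proof.
move=> [c ->]; exists (c^-1)%g.
rewrite !(morphVg (phinM _), morphVg (psinM _)) invgK.
by rewrite -!mulgA mulKg mulVg mulg1.
Qed.

Lemma twisted_conj_trans n a b c :
  twisted_conj n a b -> twisted_conj n b c -> twisted_conj n a c.
Proof.
move=> [x ->] [y ->]; exists (x * y)%g.
by rewrite !(morphVg (phinM _)) psinM phinM invgM !mulgA.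
Qed.

(** Substituting [psi^m c * b * phi^m c^-1] for [b] in the product defining the
    boost, the factor [phi^m c^-1] of each term cancels with the factor
    [psi^m c] of the next one, since both are carried to the same mixed iterate
    of [c] by commutation of [phi] and [psi]. *)
Lemma twisted_boost_conj m n a b : (m %| n)%N -> (0 < m)%N ->
  twisted_conj m a b ->
  twisted_conj n (twisted_boost m n a) (twisted_boost m n b).
Proof.
move=> /dvdnP[k ->] m0 [c ->]; exists c; rewrite /twisted_boost mulnK//.
pose T j x := iter (k * m - j.+1 * m) psi (iter (j * m) phi x).
(* the telescoping after [j] factors *)
suff tele j : (j <= k)%N ->
    (\big[*%g/1]_(0 <= i < j) T i (iter m psi c * b * iter m phi c^-1) =
     iter (k * m) psi c * \big[*%g/1]_(0 <= i < j) T i b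
     * (iter (k * m - j * m) psi (iter (j * m) phi c))^-1)%g.
  by rewrite tele// subnn (morphVg (phinM _)).
elim: j => [_|j IHj jk].
  by rewrite !big_geq// mulg1 mul0n subn0 mulgV.
rewrite !big_nat_recr//= IHj; last exact: ltnW.
have Tpsi : T j (iter m psi c) = iter (k * m - j * m) psi (iter (j * m) phi c).
  rewrite /T iter_comm -iterD; congr (iter _ psi _).
  by rewrite mulSn; have := leq_mul2r m j.+1 k; rewrite jk orbT mulSn; lia.
have Tphi x : T j (iter m phi x) =
    iter (k * m - j.+1 * m) psi (iter (j.+1 * m) phi x).
  by rewrite /T -iterD mulSnr.
have TM x y : T j (x * y)%g = (T j x * T j y)%g by rewrite /T phinM psinM.
rewrite !TM Tpsi Tphi !(morphVg (phinM _)) (morphVg (psinM _)).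
by rewrite !mulgA mulgVK.
Qed.

(** Both sides have [n %/ m] factors; factor [j] of block [i] on the left is
    factor [i * (k %/ m) + j] on the right, after commuting [phi] past [psi]. *)
Lemma twisted_boost_boost m k n a : (m %| k)%N -> (k %| n)%N -> (0 < k)%N ->
  twisted_boost k n (twisted_boost m k a) = twisted_boost m n a.
Proof.
move=> /dvdnP[q ->] /dvdnP[p ->]; rewrite muln_gt0 => /andP[q0 m0].
rewrite /twisted_boost mulnK ?muln_gt0 ?q0// mulnK// mulnA mulnK//.
rewrite prod_nat_mul; apply: eq_big_nat => i /andP[_ ip].
rewrite (big_morph _ (phinM _) (morph1g (phinM _))).
rewrite (big_morph _ (psinM _) (morph1g (psinM _))).
apply: eq_big_nat => j /andP[_ jq].
rewrite iter_comm -!iterD !mulnA -mulnDl; congr (iter _ psi _).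
rewrite -!mulnBl -mulnDl; congr (_ * m)%N.
have -> : p = (i.+1 + (p - i.+1))%N by rewrite subnKC.
rewrite addKn !mulnDl mulSn; move: ((p - i.+1) * q)%N (i * q)%N => r s; lia.
Qed.

End twisted_conjugacy.

(** * Boosting of Reidemeister classes *)

Section reidemeister_classes.
Variables (R : realType) (X : topologicalType) (x0 : X) (f g : X -> X).
Hypotheses (cf : continuous f) (cg : continuous g)
  (fx0 : f x0 = x0) (gx0 : g x0 = x0).
Hypothesis fg_comm : forall a : set (R -> X), pi1 x0 a ->
  pi1_map x0 f (pi1_map x0 g a) = pi1_map x0 g (pi1_map x0 f a).
Implicit Types (m n k : nat) (a b : set (R -> X)) (A B C : set (set (R -> X))).

Local Notation G := (fundamental_group R x0).
Local Notation phi := (@fg_map R X x0 f cf fx0).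
Local Notation psi := (@fg_map R X x0 g cg gx0).

Let phiM : {morph phi : u v / (u * v)%g} := fg_mapM cf fx0.
Let psiM : {morph psi : u v / (u * v)%g} := fg_mapM cg gx0.
Let phi_psi (u : G) : phi (psi u) = psi (phi u).
Proof. by apply/val_inj; apply: fg_comm; exact: pi1_val. Qed.

Lemma pi1_lift a : pi1 x0 a -> exists u : G, \val u = a.
Proof. by move=> pa; exists (exist (fun a => a \in pi1 x0) _ (mem_set pa)). Qed.

Lemma val_iter_fg_map (h : X -> X) (ch : continuous h) (hx0 : h x0 = x0) n
    (u : G) :
  \val (iter n (fg_map ch hx0) u) = iter n (pi1_map x0 h) (\val u).
Proof. by elim: n => [//|n IHn]; rewrite !iterS -IHn. Qed.

(** The product of [pi1] is not a monoid law on arbitrary sets of loops; this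
    lemma lets the boost be computed in a group. *)
Lemma val_twisted_boost m n (u : G) :
  \val (twisted_boost phi psi m n u) = boost x0 f g m n (\val u).
Proof.
rewrite /twisted_boost /boost.
rewrite (big_morph (fun u : G => \val u) (id1 := pi1_one x0)
  (op1 := pi1_mul x0))//.
by apply: eq_bigr => i _; rewrite !val_iter_fg_map.
Qed.

Lemma boostP m n a : pi1 x0 a -> pi1 x0 (boost x0 f g m n a).
Proof.
by move=> /pi1_lift[u <-]; rewrite -val_twisted_boost; exact: pi1_val.
Qed.

Lemma reid_equivE n (u v : G) :
  reid_equiv x0 f g n (\val u) (\val v) <-> twisted_conj phi psi n u v.
Proof.
split=> [[c /pi1_lift[w <-] uv]|[w ->]].
  by exists w; apply/val_inj; rewrite uv /= !val_iter_fg_map.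
by exists (\val w); [exact: pi1_val|rewrite /= !val_iter_fg_map].
Qed.

Lemma reid_class_eq n a b : pi1 x0 a -> pi1 x0 b ->
  reid_equiv x0 f g n a b -> reid_class x0 f g n a = reid_class x0 f g n b.
Proof.
move=> /pi1_lift[u <-] /pi1_lift[v <-] /reid_equivE uv.
apply/seteqP; split=> _ [/pi1_lift[w <-] /reid_equivE uw]; split.
- exact: pi1_val.
- apply/reid_equivE; apply: (twisted_conj_trans phiM psiM) uw.
  exact: (twisted_conj_sym phiM psiM).
- exact: pi1_val.
- by apply/reid_equivE; apply: (twisted_conj_trans phiM psiM) uw.
Qed.

Lemma reid_class_refl n a : pi1 x0 a -> reid_class x0 f g n a a.
Proof.
move=> /pi1_lift[u <-]; split; first exact: pi1_val.
by apply/reid_equivE; exact: (twisted_conj_refl phiM psiM).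
Qed.

Lemma iota_classE m n a : (m %| n)%N -> (0 < m)%N -> pi1 x0 a ->
  iota_class x0 f g m n (reid_class x0 f g m a) =
  reid_class x0 f g n (boost x0 f g m n a).
Proof.
move=> mn m0 pa; apply/seteqP; split=> [c [b [pb ab] bc]|c ac]; last first.
  by exists a => //; exact: reid_class_refl.
suff -> : reid_class x0 f g n (boost x0 f g m n a) =
          reid_class x0 f g n (boost x0 f g m n b) by [].
apply: reid_class_eq; try exact: boostP.
move: pa pb ab => /pi1_lift[u <-] /pi1_lift[v <-] /reid_equivE uv.
rewrite -!val_twisted_boost; apply/reid_equivE.
exact: (twisted_boost_conj phiM psiM).
Qed.

Lemma boost_boost m k n a : (m %| k)%N -> (k %| n)%N -> (0 < k)%N ->
  pi1 x0 a ->
  boost x0 f g k n (boost x0 f g m k a) = boost x0 f g m n a.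
Proof.
move=> mk kn k0 /pi1_lift[u <-]; rewrite -!val_twisted_boost.
by congr (\val _); exact: (twisted_boost_boost phiM psiM).
Qed.

Lemma iota_class_reid m n B : (m %| n)%N -> (0 < m)%N ->
  reid_classes x0 f g m B -> reid_classes x0 f g n (iota_class x0 f g m n B).
Proof.
by move=> mn m0 [a pa <-]; rewrite iota_classE//; exists (boost x0 f g m n a) => //;
  exact: boostP.
Qed.

Lemma iota_class_trans m k n B : (m %| k)%N -> (k %| n)%N -> (0 < k)%N ->
  reid_classes x0 f g m B ->
  iota_class x0 f g k n (iota_class x0 f g m k B) = iota_class x0 f g m n B.
Proof.
move=> mk kn k0 [a pa <-]; have m0 : (0 < m)%N by exact: dvdn_gt0 mk.
rewrite !iota_classE// ?boost_boost//; last exact: boostP.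
exact: dvdn_trans kn.
Qed.

(** With [n = q * m], any prime divisor [p] of [q] gives a level [n %/ p] that
    is a multiple of [m]; the boost of [B] to this level is the required class. *)
Lemma reduces_to_prime n A m B : (0 < n)%N -> (m < n)%N ->
  reid_classes x0 f g m B -> reduces_to x0 f g n A m B ->
  exists p (C : set (set (R -> X))), [/\ p \in primes n, reid_classes x0 f g (n %/ p) C &
    reduces_to x0 f g n A (n %/ p) C].
Proof.
move=> n0 mn mB [/dvdnP[q nE] BA].
have q1 : (1 < q)%N.
  by rewrite ltnNge; apply/negP => q1; move: mn; rewrite nE; nia.
have m0 : (0 < m)%N by move: n0; rewrite nE muln_gt0 => /andP[].
have [p_pr /dvdnP[r qE]] := (pdiv_prime q1, pdiv_dvd q).
set p := pdiv q in p_pr qE; have p0 := prime_gt0 p_pr.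
have nE' : n = (r * m * p)%N by rewrite nE qE mulnAC.
have npE : (n %/ p)%N = (r * m)%N by rewrite nE' mulnK.
have np0 : (0 < n %/ p)%N by move: n0; rewrite npE nE' muln_gt0 => /andP[].
have mnp : (m %| n %/ p)%N by rewrite npE dvdn_mull.
have npn : (n %/ p %| n)%N by rewrite npE nE' dvdn_mulr.
exists p, (iota_class x0 f g m (n %/ p) B); split.
- by rewrite mem_primes p_pr n0 nE' dvdn_mull.
- exact: iota_class_reid.
- by split=> //; rewrite iota_class_trans.
Qed.

End reidemeister_classes.

(** * Finiteness of the set of Nielsen classes *)

Section nielsen_classes.
Variables (R : realType) (X : topologicalType).
Implicit Types (x y z : X) (F H : X -> X).

Local Notation I01 := `[(0 : R), (1 : R)]%classic.

Lemma nielsen_equiv_sym F H x y :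
  nielsen_equiv R F H x y -> nielsen_equiv R F H y x.
Proof.
move=> [c p h]; exists (path_rev c); first exact: is_path_rev.
exact: path_homotopic_rev h.
Qed.

Lemma nielsen_equiv_trans F H x y z :
  nielsen_equiv R F H x y -> nielsen_equiv R F H y z -> nielsen_equiv R F H x z.
Proof.
move=> [c1 p1 h1] [c2 p2 h2]; exists (path_cat c1 c2).
  exact: is_path_cat p1 p2.
have E (K : X -> X) : K \o path_cat c1 c2 = path_cat (K \o c1) (K \o c2).
  by apply/funext => t; rewrite /path_cat/=; case: ifP.
by rewrite !E; exact: path_homotopic_cat h1 h2.
Qed.

(** The homotopy is the straight-line one between the images of the paths in
    the Euclidean space. *)
Lemma euclidean_path_homotopic (d : nat) (V : set X) x y (c1 c2 : R -> X) :
  euclidean_open R d V -> is_path x y c1 -> is_path x y c2 ->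
  (forall t, 0 <= t <= 1 -> V (c1 t)) -> (forall t, 0 <= t <= 1 -> V (c2 t)) ->
  path_homotopic x y c1 c2.
Proof.
move=> [h [ch hinj hopen hV]] [cc1 c10 c11] [cc2 c20 c21] V1 V2.
(* [e] is the chart, extended arbitrarily outside of [V] *)
have [e eK] : exists e : X -> 'rV[R]_d, forall y, V y -> h (e y) = y.
  have /choice[e eP] : forall y, exists v, V y -> h v = y.
    by move=> z; have [|nVz] := pselect (V z); [rewrite -hV => -[v _ <-]; exists v|exists 0].
  by exists e.
have hK v : e (h v) = v by apply: hinj; rewrite eK// -hV; exists v.
have ce : {within V, continuous e}.
  apply/subspace_continuousP => z Vz O Oz.
  have [Q [oQ Qz] QO] : exists2 Q, open_nbhs (e z) Q & Q `<=` O.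
    by move: Oz; rewrite nbhsE.
  have : nbhs z (h @` Q).
    apply: open_nbhs_nbhs; split; first exact: hopen.
    by exists (e z) => //; exact: eK.
  by apply: filterS => _ [v Qv <-] _; apply: QO; rewrite /from_subspace/= hK.
have ce1 : {within I01, continuous (e \o c1)}.
  by apply: within_continuous_comp_sub ce cc1 _ => t; rewrite /= in_itv; exact: V1.
have ce2 : {within I01, continuous (e \o c2)}.
  by apply: within_continuous_comp_sub ce cc2 _ => t; rewrite /= in_itv; exact: V2.
apply: (@path_homotopicI _ _ _ _ _ _
  (h \o (fun p => (1 - p.1) *: e (c1 p.2) + p.1 *: e (c2 p.2)))) => /=.
- apply: within_continuous_comp => [v _|]; first exact: ch.
  have csnd (c : R -> X) : {within I01, continuous (e \o c)} ->
      {within I01 `*` I01, continuous (fun p : R * R => e (c p.2))}.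
    move=> cc; apply: (@within_continuous_comp_sub _ _ _ _ _ snd (e \o c) cc).
      by apply: continuous_subspaceT => p; exact: cvg_snd.
    by move=> p [].
  move=> p; apply: cvgD; apply: cvgZ.
  + apply: cvgB; first exact: cvg_cst.
    by apply: (@continuous_subspaceT _ _ (I01 `*` I01) fst) => q; exact: cvg_fst.
  + exact: csnd ce1 p.
  + by apply: (@continuous_subspaceT _ _ (I01 `*` I01) fst) => q; exact: cvg_fst.
  + exact: csnd ce2 p.
- by move=> t t01; rewrite subr0 scale1r scale0r addr0 eK//; exact: V1.
- by move=> t t01; rewrite subrr scale1r scale0r add0r eK//; exact: V2.
- by move=> s s01; rewrite c10 c20 -scalerDl subrK scale1r -c10 eK//; apply: V1; lra.
- by move=> s s01; rewrite c11 c21 -scalerDl subrK scale1r -c11 eK//; apply: V1; lra.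
Qed.

(** The path is the preimage of a segment: a ball around the image of [x] in a
    chart, small enough for its preimage to lie in [U], is convex. *)
Lemma near_path_in_nbhs (d : nat) x (U : set X) :
  closed_manifold R d X -> nbhs x U ->
  \forall y \near x, exists2 c : R -> X, is_path x y c &
    forall t, 0 <= t <= 1 -> U (c t).
Proof.
move=> [_ _ /(_ x)[V [h [ch hinj hopen <-]] [u _ ux]]] Ux.
have : nbhs u (h @^-1` U) by apply: ch; rewrite ux.
rewrite -nbhs_ballE => -[e /= e0 eU].
have : nbhs x (h @` (ball u e)°).
  apply: open_nbhs_nbhs; split; first by apply: hopen; exact: open_interior.
  by exists u => //; apply: nbhsx_ballx.
apply: filterS => _ [v /interior_subset uv <-].
exists (fun t => h (u + t *: (v - u))).
  split; rewrite ?scale0r ?addr0 ?scale1r ?subrKC//.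
  apply: continuous_subspaceT => t; apply: continuous_comp; last exact: ch.
  apply: cvgD; first exact: cvg_cst.
  by apply: cvgZ; [exact: cvg_id|exact: cvg_cst].
move=> t t01; apply: eU; move: uv; rewrite -ball_normE /=.
rewrite opprD addrA subrr add0r normrN normrZ distrC.
by apply: le_lt_trans; rewrite ler_piMl// ger0_norm; lra.
Qed.

(** At a coincidence [x], use paths from [x] so short that both maps send them
    into one chart around [F x].  Elsewhere, there are no coincidences near [x]
    because the space is separated. *)
Lemma nielsen_equiv_near (d : nat) F H x :
  closed_manifold R d X -> continuous F -> continuous H ->
  \forall y \near x, coin F H y -> coin F H x /\ nielsen_equiv R F H x y.
Proof.
move=> mX cF cH; have [T2 _ chart] := mX.
have [FHx|FHx] := eqVneq (F x) (H x); last first.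
  move: T2; rewrite open_hausdorff => /(_ _ _ FHx)[[A B] /= [/set_mem xA /set_mem xB]].
  move=> [oA oB /eqP AB0].
  have nA : nbhs x (F @^-1` A) by apply: cF; exact: open_nbhs_nbhs.
  have nB : nbhs x (H @^-1` B) by apply: cH; exact: open_nbhs_nbhs.
  apply: filterS2 nA nB => y Ay By FHy.
  by have : (A `&` B) (F y); [split=> //; rewrite FHy|rewrite AB0].
have [V eV VFx] := chart (F x).
have oV : open V by have [h [_ _ ho <-]] := eV; exact: ho openT.
have nU : nbhs x (F @^-1` V `&` H @^-1` V).
  apply: filterI; [apply: cF|apply: cH; rewrite -FHx]; exact: open_nbhs_nbhs.
have := near_path_in_nbhs mX nU; apply: filterS => y [c pc Vc] FHy.
split=> //; exists c => //.
apply: (euclidean_path_homotopic eV).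
- exact: is_path_map.
- by rewrite FHx FHy; exact: is_path_map.
- by move=> t /Vc[].
- by move=> t /Vc[].
Qed.

(** Compactness is applied to the filter [Fin] of the properties that hold of all
    sufficiently large sets of centres. *)
Lemma compact_nbhs_cover (T : topologicalType) (U : T -> set T) :
  compact [set: T] -> (forall t, nbhs t (U t)) ->
  exists2 D : set T, finite_set D & forall s, exists2 t, D t & U t s.
Proof.
move=> /compact_near_coveringP cT nU.
pose Fin : set_system (set T) :=
  [set S | exists2 D, finite_set D & forall D', D `<=` D' -> S D'].
have FinF : Filter Fin.
  split; first by exists set0.
    move=> P Q [D fD PD] [E fE QE]; exists (D `|` E); first by rewrite finite_setU.
    by move=> D'; rewrite subUset => -[? ?]; split; auto.
  by move=> P Q PQ [D fD PD]; exists D => // D' /PD/PQ.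
have [|D fD cov] := cT _ Fin (fun D s => exists2 t, D t & U t s) FinF.
  move=> x _; exists (U x, [set D : set T | D x]) => /=.
    by split; [exact: nU|exists [set x] => // D'; apply].
  by move=> [y D] /= [Uy Dx]; exists x.
by exists D => // y; exact: cov.
Qed.

Lemma finite_nielsen_classes (d : nat) F H :
  closed_manifold R d X -> continuous F -> continuous H ->
  finite_set [set A | nielsen_class R F H A].
Proof.
move=> mX cF cH; have [_ cX _] := mX.
have [D fD cov] := compact_nbhs_cover cX
  (fun x => nielsen_equiv_near x mX cF cH).
apply: (@sub_finite_set _ _
  [set [set y | coin F H y /\ nielsen_equiv R F H x y] | x in D]); last first.
  exact: finite_image.
move=> _ /= [x cx ->]; have [z Dz /(_ cx)[cz zx]] := cov x.
exists z => //; apply/seteqP; split=> y [cy xy]; split=> //.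
  by apply: nielsen_equiv_trans xy; exact: nielsen_equiv_sym zx.
exact: nielsen_equiv_trans zx xy.
Qed.

End nielsen_classes.

(** * Cardinals of finite covers *)

Section counting.
Variable T : choiceType.
Implicit Types A B : set T.

Lemma card_fset_set_le A B : finite_set B -> A `<=` B ->
  (#|` fset_set A| <= #|` fset_set B|)%N.
Proof.
move=> fB AB; apply: fsubset_leq_card.
by rewrite -fset_set_sub//; exact: sub_finite_set fB.
Qed.

Lemma card_fset_setU_le A B : finite_set A -> finite_set B ->
  (#|` fset_set (A `|` B)| <= #|` fset_set A| + #|` fset_set B|)%N.
Proof. by move=> fA fB; rewrite fset_setU// leq_card_fsetU. Qed.

Lemma card_fset_set_image_le (U : choiceType) (h : U -> T) (C : set U) :
  finite_set C -> (#|` fset_set (h @` C)| <= #|` fset_set C|)%N.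
Proof. by move=> fC; rewrite fset_set_image//; exact: leq_imfset_card. Qed.

Lemma card_fset_set_cover (I : eqType) (U : choiceType) (s : seq I) A B
    (C : I -> set U) (h : I -> U -> T) :
  finite_set B -> (forall i, finite_set (C i)) ->
  A `<=` B `|` [set t | exists2 i, i \in s & (h i @` C i) t] ->
  (#|` fset_set A| <=
   #|` fset_set B| + \sum_(i <- s) #|` fset_set (C i)|)%N.
Proof.
move=> + fC; elim: s B => [|i s IHs] B fB AB.
  rewrite big_nil addn0; apply: card_fset_set_le => //.
  by move=> t /AB[//|[]].
have fhC : finite_set (h i @` C i) by exact: finite_image.
have /leq_trans -> // : (#|` fset_set A| <= #|` fset_set (B `|` h i @` C i)|
    + \sum_(j <- s) #|` fset_set (C j)|)%N.
  apply: IHs; first by rewrite finite_setU.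
  move=> t /AB[Bt|[j]]; first by left; left.
  by rewrite in_cons => /predU1P[-> Ct|js Ct]; [left; right|right; exists j].
rewrite big_cons addnA leq_add2r (leq_trans (card_fset_setU_le fB fhC))//.
by rewrite leq_add2l; exact: card_fset_set_image_le.
Qed.

End counting.

(** * Finiteness of the set of essential classes *)

Lemma iter_continuous (X : topologicalType) (f : X -> X) n :
  continuous f -> continuous (iter n f).
Proof.
move=> cf; elim: n => [|n IHn] x; first exact: cvg_id.
by apply: (@continuous_comp _ _ _ (iter n f) f); [exact: IHn|exact: cf].
Qed.

(** A class of nonzero index is in the image of [rho], by definition of the
    index. *)
Lemma finite_essential (R : realType) (d : nat) (X : topologicalType) (x0 : X)
    (f g : X -> X) (n : nat) :
  closed_manifold R d X -> continuous f -> continuous g ->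
  finite_set [set A | @essential R d X x0 f g n A].
Proof.
move=> mX cf cg.
have fN := finite_nielsen_classes mX (@iter_continuous _ f n cf)
  (@iter_continuous _ g n cg).
apply: sub_finite_set (finite_image (@rho R X x0 f g n) fN) => A [_].
by rewrite /Ind; case: pselect => [[N [? NA]] _|_ /eqP//]; exists N.
Qed.

(** * The inequalities *)

Theorem theorem4p6 (R : realType) (d : nat) (X : topologicalType) (x0 : X)
    (f g : X -> X) (n : nat) :
  closed_manifold R d X -> connected [set: X] ->
  continuous f -> continuous g -> f x0 = x0 -> g x0 = x0 ->
  (forall a : set (R -> X), pi1 x0 a ->
    pi1_map x0 f (pi1_map x0 g a) = pi1_map x0 g (pi1_map x0 f a)) ->
  (0 < n)%N ->
  coincidence_essentially_reducible R d x0 f g ->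
  (NP R d x0 f g n <= nielsen_number R d x0 f g n)%N /\
  (nielsen_number R d x0 f g n)%:Z
    - \sum_(p <- primes n) (nielsen_number R d x0 f g (n %/ p))%:Z
  <= (NP R d x0 f g n)%:Z.
Proof.
move=> mX _ cf cg fx0 gx0 comm n0 ess_red.
have fE m := finite_essential x0 m mX cf cg.
have NPsub : [set A | @essential R d X x0 f g n A /\
    irreducible_class x0 f g n A] `<=` [set A | @essential R d X x0 f g n A].
  by move=> A [].
split; first exact: card_fset_set_le.
rewrite lerBlDr -(big_morph Posz PoszD (erefl 0%Z)) -PoszD lez_nat.
apply: (card_fset_set_cover (h := fun p => iota_class x0 f g (n %/ p) n)).
- exact: sub_finite_set NPsub _.
- by move=> p; exact: fE.
move=> A /= eA.
have [irrA|redA] := pselect (irreducible_class x0 f g n A); [by left|right].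
have /existsNP[m /existsNP[B]] := redA.
move=> /not_implyP[mn /not_implyP[mB /contrapT AB]].
have [p [C [pn rC AC]]] :=
  reduces_to_prime cf cg fx0 gx0 comm n0 mn mB AB.
by exists p => //; exists C; [exact: ess_red AC|exact: AC.2].
Qed.
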